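(* Let $\bm{u}_h$ be piecewise constant, i.e. constant on each element $D^k$. Then the volume entropy residual $$\delta_k(\bm{u}_h)=\sum_{m=1}^d\left[\left(-\bm{f}_m(\bm{u}_h),\frac{\partial\Pi_N\bm{v}(\bm{u}_h)}{\partial x_m}\right)_{D^k}+\langle\psi_m(\tilde{\bm{u}})n_m,1\rangle_{\partial D^k}\right]$$ vanishes on every element, and hence the entropy correction artificial viscosity vanishes ($\epsilon_k(\bm{u}_h)=0$ for all $k$, so that $\bm{g}_{\rm visc}=\bm{0}$). Consequently, if the baseline DG formulation $$\left(\frac{\partial\bm{u}_h}{\partial t},\bm{w}\right)_{D^k}+\sum_{m=1}^d\left(-\bm{f}_m(\bm{u}_h),\frac{\partial\bm{w}}{\partial x_m}\right)_{D^k}+\langle\bm{f}_n^*,\bm{w}\rangle_{\partial D^k}=\bm{0}\qquad\forall\bm{w}\in[P^N(D^k)]^n$$ is contact preserving, then the formulation obtained by replacing the right-hand side $\bm{0}$ with $(\bm{g}_{\rm visc},\bm{w})_{D^k}$ is also contact preserving.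
   Context: Consider a system of conservation laws $\partial_t\bm{u}+\sum_{m=1}^d\partial_{x_m}\bm{f}_m(\bm{u})=0$, $\bm{u}\in\mathbb{R}^n$, with scalar convex entropy $S(\bm{u})$, entropy variables $\bm{v}(\bm{u})=\partial S/\partial\bm{u}$ (an invertible map with inverse $\bm{u}(\bm{v})$), entropy fluxes $F_m$ and entropy potentials $\psi_m=\bm{v}^T\bm{f}_m-F_m$. The domain is triangulated by affine simplices $D^k$ with outward unit normal $\bm{n}=(n_1,\dots,n_d)$; $P^N(D^k)$ denotes polynomials of total degree at most $N$. $(\cdot,\cdot)_{D^k}$ and $\langle\cdot,\cdot\rangle_{\partial D^k}$ are $L^2$ inner products evaluated by quadrature rules that define an inner product on $P^N(D^k)$ in the volume and integrate constants exactly on each face. $\Pi_N$ is the $L^2$ projection onto $P^N(D^k)$ (with the same volume quadrature), and $\tilde{\bm{u}}=\bm{u}(\Pi_N\bm{v}(\bm{u}_h))$. $\bm{f}_n^*$ is a numerical interface flux. The viscous term $\bm{g}_{\rm visc}\in[P^N(D^k)]^n$ is defined, with $\bm{v}_h=\Pi_N\bm{v}(\bm{u}_h)$, by: for all $\bm{w}\in[P^N(D^k)]^n$ and $i=1,\dots,d$, $$(\bm{\Theta}_i,\bm{w})_{D^k}=\left(-\bm{v}_h,\frac{\partial\bm{w}}{\partial x_i}\right)_{D^k}+\left\langle\left(\{\{\bm{v}_h\}\}-\frac\beta2[\![\bm{v}_h]\!]\right)n_i,\bm{w}\right\rangle_{\partial D^k},\quad(\bm{\sigma}_i,\bm{w})_{D^k}=\left(\sum_{j=1}^d\epsilon_k(\bm{u}_h)\bm{K}_{ij}\bm{\Theta}_j,\bm{w}\right)_{D^k},$$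 $$(\bm{g}_{\rm visc},\bm{w})_{D^k}=\sum_{i=1}^d\left[\left(-\bm{\sigma}_i,\frac{\partial\bm{w}}{\partial x_i}\right)_{D^k}+\left\langle\left(\{\{\bm{\sigma}_i\}\}+\frac\beta2[\![\bm{\sigma}_i]\!]\right)n_i,\bm{w}\right\rangle_{\partial D^k}\right],$$ where $\bm{\Theta}_i,\bm{\sigma}_i\in[P^N(D^k)]^n$, $[\![u]\!]=u^+-u^-$, $\{\{u\}\}=\frac12(u^++u^-)$ with interior trace $u^-$ and exterior trace $u^+$, $\beta={\rm sign}(\bm{v}_0\cdot\bm{n})$ for a fixed $\bm{v}_0\in\mathbb{R}^d$, and the $\bm{K}_{ij}$ (possibly depending on $\bm{u}_h$) are blocks of a symmetric positive semi-definite matrix. The coefficient is constant on each element and given by $\epsilon_k(\bm{u}_h)=a/b$ with $a=-\min(0,\delta_k(\bm{u}_h))$ and $b=\sum_{i,j=1}^d(\bm{K}_{ij}\bm{\Theta}_j,\bm{\Theta}_i)_{D^k}$, where the ratio $a/b$ is evaluated as $ab/(b^2+\delta)$ for a small fixed $\delta>0$. The domain is taken periodic, so every face has an exterior trace. A semi-discrete scheme is called contact preserving if every stationary contact solution of the conservation law (a stationary weak solution consisting of constant states separated by contact discontinuities) that is constant on each element is a steady state of the scheme, i.e. the scheme gives $\partial\bm{u}_h/\partial t=\bm{0}$ at it. *)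

(* Defs.v *)
From HB Require Import structures.
From mathcomp Require Import all_boot all_order all_algebra.
From mathcomp Require Import all_classical all_reals all_analysis.
From mathcomp Require Import -(notations) mpoly.

Set Implicit Arguments.
Unset Strict Implicit.
Unset Printing Implicit Defensive.

Import Order.TTheory GRing.Theory Num.Theory.
Import numFieldNormedType.Exports.

Local Open Scope classical_set_scope.
Local Open Scope ring_scope.

(* Throughout, the space dimension is d.+1 (so that it is positive), points of
   R^(d+1) are row vectors and states of R^n are column vectors. *)

Section Calculus.
Context {R : realType}.

Definition dotc n (a b : 'cV[R]_n) : R := (a^T *m b) 0 0.

Definition dotr n (a b : 'rV[R]_n) : R := (a *m b^T) 0 0.

Definition partial d (V : normedModType R) (m : 'I_d) (w : 'rV[R]_d -> V) :
  'rV[R]_d -> V := fun x => 'D_(delta_mx 0 m) w x.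

Definition gradient n (S : 'cV[R]_n -> R) (u : 'cV[R]_n) : 'cV[R]_n :=
  \col_i 'D_(delta_mx i 0) S u.

(* A polynomial is used through its values on the whole of R^d; no information
   is lost with respect to its restriction to a nondegenerate simplex. *)
Definition polyP d (N : nat) (f : 'rV[R]_d -> R) : Prop :=
  exists p : mpoly d R, (msize p <= N.+1)%N /\
    f = fun x => meval (fun i => x 0 i) p.

Definition polyPn d n (N : nat) (f : 'rV[R]_d -> 'cV[R]_n) : Prop :=
  forall i, polyP N (fun x => f x i 0).

(* Lebesgue integral over R^m, as an iterated integral. *)
Fixpoint integralRn (m : nat) : ('rV[R]_m -> R) -> R :=
  match m return ('rV[R]_m -> R) -> R with
  | 0 => fun g => g 0
  | m'.+1 => fun g =>
      \int[lebesgue_measure]_t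
        integralRn (fun y : 'rV[R]_m' => g (row_mx (t%:M : 'rV[R]_1) y))
  end.

Definition integral_on m (A : set 'rV[R]_m) (g : 'rV[R]_m -> R) : R :=
  integralRn (fun x => \1_A x * g x).

Definition conv_hull d m (p : 'I_m -> 'rV[R]_d) : set 'rV[R]_d :=
  [set x | exists t : 'I_m -> R,
     [/\ forall j, 0 <= t j, \sum_j t j = 1 & x = \sum_j t j *: p j]].

End Calculus.

(* [adm] is the set of admissible states (all of R^n, or for instance the states
   of positive density and pressure); the entropy variables are invertible on
   it, with inverse [state_of]. *)
Record conservation_law (R : realType) (n d : nat) := ConservationLaw {
  adm : set 'cV[R]_n;
  flux : 'I_d -> 'cV[R]_n -> 'cV[R]_n;
  entropy : 'cV[R]_n -> R;
  entropy_flux : 'I_d -> 'cV[R]_n -> R;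
  state_of : 'cV[R]_n -> 'cV[R]_n;
  adm_open : open adm;
  adm_convex : @convex_set R 'cV[R]_n adm;
  flux_diff : forall m u, adm u -> differentiable (flux m) u;
  entropy_diff : forall u, adm u -> differentiable entropy u;
  entropy_convex : @convex_function R 'cV[R]_n adm entropy;
  entropy_flux_diff : forall m u, adm u -> differentiable (entropy_flux m) u;
  entropy_fluxP : forall m u h, adm u ->
    'd (entropy_flux m) u h = dotc (gradient entropy u) ('d (flux m) u h);
  state_ofK : forall u, adm u -> state_of (gradient entropy u) = u
}.

Section ConservationLaw.
Context {R : realType} {n d : nat} (law : conservation_law R n d).

Definition entropy_var (u : 'cV[R]_n) : 'cV[R]_n := gradient (entropy law) u.

Definition entropy_potential (m : 'I_d) (u : 'cV[R]_n) : R :=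
  dotc (entropy_var u) (flux law m u) - entropy_flux law m u.

Definition normal_jac (nu : 'rV[R]_d) (u r : 'cV[R]_n) : 'cV[R]_n :=
  \sum_m nu 0 m *: 'd (flux law m) u r.

Definition characteristic_field (nu : 'rV[R]_d) (lambda : 'cV[R]_n -> R) :=
  forall u, adm law u -> differentiable lambda u /\
    exists2 r, r != 0 & normal_jac nu u r = lambda u *: r.

Definition linearly_degenerate (nu : 'rV[R]_d) (lambda : 'cV[R]_n -> R) :=
  forall u r, adm law u -> normal_jac nu u r = lambda u *: r ->
    'd lambda u r = 0.

(* A contact discontinuity of speed s in direction nu: the two states lie on a
   common integral curve of a linearly degenerate characteristic field (a curve
   tangent to the eigenspaces, whose dimension may exceed one), and s is the
   characteristic speed on both sides. *)
Definition contact_discontinuity (nu : 'rV[R]_d) (s : R) (ul ur : 'cV[R]_n) :=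
  ul <> ur /\
  exists (lambda : 'cV[R]_n -> R) (gamma : R -> 'cV[R]_n),
  [/\ characteristic_field nu lambda, linearly_degenerate nu lambda,
      lambda ul = s /\ lambda ur = s,
      [/\ gamma 0 = ul, gamma 1 = ur,
          forall t, derivable gamma t 1 & continuous (derive1 gamma)]
    & forall t, 0 <= t <= 1 -> adm law (gamma t) /\
        normal_jac nu (gamma t) (derive1 gamma t)
          = lambda (gamma t) *: derive1 gamma t].

End ConservationLaw.

(* A conforming triangulation of a periodic domain.  The domain is the union of
   the simplices, a fundamental domain of the lattice spanned by the rows of
   [period].  Face i of an element is the one opposite to its vertex i; across
   it lies the translate of the element [nbr k i] by the lattice vector
   [nbr_shift k i], so that the face is shared by the two simplices. *)
Record periodic_mesh (R : realType) (d : nat) := PeriodicMesh {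
  elem :> finType;
  vertex : elem -> 'I_d.+2 -> 'rV[R]_d.+1;
  normal : elem -> 'I_d.+2 -> 'rV[R]_d.+1;
  period : 'M[R]_d.+1;
  nbr : elem -> 'I_d.+2 -> elem;
  nbr_shift : elem -> 'I_d.+2 -> 'rV[int]_d.+1;
  lattice (z : 'rV[int]_d.+1) : 'rV[R]_d.+1 := map_mx intr z *m period;
  simplex (k : elem) : set 'rV[R]_d.+1 := conv_hull (vertex k);
  period_unit : period \in unitmx;
  vertex_indep : forall k,
    \matrix_(j < d.+1) (vertex k (lift ord0 j) - vertex k ord0) \in unitmx;
  normal_unit : forall k i, dotr (normal k i) (normal k i) = 1;
  normal_orth : forall k i (j j' : 'I_d.+1),
    dotr (normal k i) (vertex k (lift i j) - vertex k (lift i j')) = 0;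
  normal_outward : forall k i (j : 'I_d.+1),
    dotr (normal k i) (vertex k i - vertex k (lift i j)) < 0;
  mesh_cover : forall x, exists k z, simplex k (x - lattice z);
  mesh_disjoint : forall k k' z, k <> k' \/ z <> 0 ->
    (simplex k)° `&` [set x | (simplex k')° (x - lattice z)] = set0;
  nbr_conforming : forall k (i : 'I_d.+2), exists i' : 'I_d.+2,
    [set vertex k (lift i j) | j in [set: 'I_d.+1]] =
    [set vertex (nbr k i) (lift i' j) + lattice (nbr_shift k i)
       | j in [set: 'I_d.+1]];
  nbr_distinct : forall k i, ~ (nbr k i = k /\ nbr_shift k i = 0)
}.

Section Mesh.
Context {R : realType} {d : nat} (T : periodic_mesh R d).

Definition face (k : T) (i : 'I_d.+2) : set 'rV[R]_d.+1 :=
  conv_hull (fun j : 'I_d.+1 => vertex k (lift i j)).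

Definition face_edges (k : T) (i : 'I_d.+2) : 'M[R]_(d, d.+1) :=
  \matrix_(j < d) (vertex k (lift i (lift ord0 j)) - vertex k (lift i ord0)).

(* Surface measure of a face: the d-dimensional simplex spanned by the rows of
   E has measure sqrt (det (E E^T)) / d!. *)
Definition face_area (k : T) (i : 'I_d.+2) : R :=
  Num.sqrt (\det (face_edges k i *m (face_edges k i)^T)) / d`!%:R.

End Mesh.

(* Quadrature rules are lists of (node, weight) pairs. *)
Record quadrature (R : realType) (d : nat) (T : periodic_mesh R d) (N : nat) :=
  Quadrature {
  vol_rule : T -> seq ('rV[R]_d.+1 * R);
  face_rule : T -> 'I_d.+2 -> seq ('rV[R]_d.+1 * R);
  vol_nodes : forall k q, q \in vol_rule k -> simplex k q.1;
  face_nodes : forall k i q, q \in face_rule k i -> face k i q.1;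
  vol_posdef : forall k p, polyP N p -> p <> (fun=> 0) ->
    0 < \sum_(q <- vol_rule k) q.2 * (p q.1 * p q.1);
  face_exact : forall k i, \sum_(q <- face_rule k i) q.2 = face_area k i
}.

Section Scheme.
Context {R : realType} {d n : nat} (N : nat) (law : conservation_law R n d.+1)
  (T : periodic_mesh R d) (Q : quadrature T N).

Local Notation point := 'rV[R]_d.+1.
Local Notation state := 'cV[R]_n.
Local Notation field := (T -> point -> state).

Definition vol_int (k : T) (h : point -> R) : R :=
  \sum_(q <- vol_rule Q k) q.2 * h q.1.

(* The integrand may depend on the face, through the normal and the traces. *)
Definition face_int (k : T) (h : 'I_d.+2 -> point -> R) : R :=
  \sum_(i < d.+2) \sum_(q <- face_rule Q k i) q.2 * h i q.1.

Definition vol_ip (k : T) (f g : point -> state) : R :=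
  vol_int k (fun x => dotc (f x) (g x)).

Definition face_ip (k : T) (f : 'I_d.+2 -> point -> state)
  (g : point -> state) : R := face_int k (fun i x => dotc (f i x) (g x)).

(* The element p of [P^N]^n determined by (p, w)_k = L w for all w in [P^N]^n;
   it exists and is unique for linear L, by [vol_posdef]. *)
Definition weak_solve (k : T) (L : (point -> state) -> R) : point -> state :=
  xget (fun=> 0) [set p | polyPn N p /\
    forall w, polyPn N w -> vol_ip k p w = L w].

Definition L2proj (k : T) (g : point -> state) : point -> state :=
  weak_solve k (vol_ip k g).

Definition ext_trace (u : field) (k : T) (i : 'I_d.+2) (x : point) : state :=
  u (nbr k i) (x - lattice T (nbr_shift k i)).

Definition jump (u : field) k i x : state := ext_trace u k i x - u k x.

Definition avg (u : field) k i x : state := 2^-1 *: (ext_trace u k i x + u k x).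

(* v_h and u-tilde *)
Definition proj_entropy_var (u : field) : field :=
  fun k => L2proj k (fun x => entropy_var law (u k x)).

Definition entropy_proj (u : field) : field :=
  fun k x => state_of law (proj_entropy_var u k x).

Definition entropy_residual (u : field) (k : T) : R :=
  \sum_(m < d.+1)
    (vol_ip k (fun x => - flux law m (u k x)) (partial m (proj_entropy_var u k))
     + face_int k (fun i x =>
         entropy_potential law m (entropy_proj u k x) * normal k i 0 m * 1)).

(* [Kv u k x i j] is the block K_ij at the point x of D^k, for the solution u. *)
Definition psd_blocks (K : 'I_d.+1 -> 'I_d.+1 -> 'M[R]_n) : Prop :=
  let M := \mxblock_(i < d.+1, j < d.+1) K i j in
  M^T = M /\ forall y, 0 <= dotc y (M *m y).

Section Viscosity.
Context (Kv : field -> T -> point -> 'I_d.+1 -> 'I_d.+1 -> 'M[R]_n)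
  (v0 : point) (delta : R).

Definition switch (k : T) (i : 'I_d.+2) : R := Num.sg (dotr v0 (normal k i)).

Definition visc_theta (u : field) (i : 'I_d.+1) : field := fun k =>
  let vh := proj_entropy_var u in
  weak_solve k (fun w =>
    vol_ip k (fun x => - vh k x) (partial i w)
    + face_ip k (fun e x =>
        normal k e 0 i *: (avg vh k e x - (switch k e / 2) *: jump vh k e x)) w).

Definition visc_a (u : field) (k : T) : R :=
  - Num.min 0 (entropy_residual u k).

Definition visc_b (u : field) (k : T) : R :=
  \sum_(i < d.+1) \sum_(j < d.+1)
    vol_ip k (fun x => Kv u k x i j *m visc_theta u j k x) (visc_theta u i k).

(* The ratio a / b, in its regularized evaluation. *)
Definition visc_coeff (u : field) (k : T) : R :=
  visc_a u k * visc_b u k / (visc_b u k ^+ 2 + delta).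

Definition visc_sigma (u : field) (i : 'I_d.+1) : field := fun k =>
  weak_solve k (vol_ip k (fun x =>
    \sum_(j < d.+1) visc_coeff u k *: (Kv u k x i j *m visc_theta u j k x))).

Definition gvisc (u : field) : field := fun k =>
  weak_solve k (fun w => \sum_(i < d.+1)
    (vol_ip k (fun x => - visc_sigma u i k x) (partial i w)
     + face_ip k (fun e x =>
         normal k e 0 i *: (avg (visc_sigma u i) k e x
           + (switch k e / 2) *: jump (visc_sigma u i) k e x)) w)).

(* Semi-discrete schemes are relations between the numerical solution u and its
   time derivative [dtu].  The numerical interface flux f_n^* is an arbitrary
   functional of u, evaluated at a point of a face of an element: this covers
   two-point fluxes of the traces of u or of its entropy projection. *)
Context (fstar : field -> T -> 'I_d.+2 -> point -> state).

Definition dg_form (u dtu : field) (k : T) (w : point -> state) : R :=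
  vol_ip k (dtu k) w
  + \sum_(m < d.+1) vol_ip k (fun x => - flux law m (u k x)) (partial m w)
  + face_ip k (fstar u k) w.

Definition baseline_scheme (u dtu : field) : Prop := forall k,
  polyPn N (dtu k) /\ forall w, polyPn N w -> dg_form u dtu k w = 0.

Definition visc_scheme (u dtu : field) : Prop := forall k,
  polyPn N (dtu k) /\
  forall w, polyPn N w -> dg_form u dtu k w = vol_ip k (gvisc u k) w.

End Viscosity.

Definition has_states (u : field) (c : T -> state) : Prop :=
  forall k, adm law (c k) /\ forall x, simplex k x -> u k x = c k.

Definition piecewise_constant (u : field) : Prop := exists c, has_states u c.

(* C^1 functions on the periodic domain. *)
Definition test_function (phi : point -> R) : Prop :=
  [/\ forall z x, phi (x + lattice T z) = phi x,
      forall x, differentiable phi x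
    & forall m, continuous (partial m phi)].

Definition stationary_weak_solution (u : field) : Prop :=
  forall (phi : point -> R) (c : 'I_n), test_function phi ->
    \sum_(k : T) integral_on (simplex k)
      (fun x => \sum_(m < d.+1) flux law m (u k x) c 0 * partial m phi x) = 0.

Definition stationary_contact (u : field) : Prop :=
  stationary_weak_solution u /\
  exists2 c, has_states u c &
    forall k i, c k <> c (nbr k i) ->
      contact_discontinuity law (normal k i) 0 (c k) (c (nbr k i)).

Definition contact_preserving (scheme : field -> field -> Prop) : Prop :=
  forall u, stationary_contact u -> scheme u (fun _ _ => 0).

End Scheme.

(* Main.v *)
(* For constant u_h the projected entropy variables are constant, so the volume
   part of the residual vanishes, and its surface part is psi_m(c) times the
   m-th component of the sum of |F_i| n_i over the faces F_i of a simplex.  That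
   sum is zero because |F_i| n_i is a multiple, with a factor independent of i,
   of the gradient of the i-th barycentric coordinate. *)

Require Import Defs.
From HB Require Import structures.
From mathcomp Require Import all_boot all_order all_algebra.
From mathcomp Require Import all_classical all_reals all_analysis.
From mathcomp Require Import -(notations) mpoly.
From mathcomp Require Import ring.
(* [polyP] also names a lemma of mathcomp's [poly]. *)
Import Defs.
Import Order.TTheory GRing.Theory Num.Theory.
Import numFieldNormedType.Exports.
Local Open Scope classical_set_scope.
Local Open Scope ring_scope.

Set Implicit Arguments.
Unset Strict Implicit.
Unset Printing Implicit Defensive.

(** * Linearity of the dot products *)

Section DotProduct.
Context {R : realType}.

Lemma dotcE n (a b : 'cV[R]_n) : dotc a b = \sum_i a i 0 * b i 0.
Proof. by rewrite /dotc mxE; apply: eq_bigr => i _; rewrite mxE. Qed.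

Lemma dotcBl n (a b c : 'cV[R]_n) : dotc (a - b) c = dotc a c - dotc b c.
Proof. by rewrite /dotc linearB /= mulmxBl !mxE. Qed.

Lemma dot0c n (a : 'cV[R]_n) : dotc 0 a = 0.
Proof. by rewrite /dotc trmx0 mul0mx mxE. Qed.

Lemma dotc0 n (a : 'cV[R]_n) : dotc a 0 = 0.
Proof. by rewrite /dotc mulmx0 mxE. Qed.

Lemma dotrBr n (a b c : 'rV[R]_n) : dotr a (b - c) = dotr a b - dotr a c.
Proof. by rewrite /dotr linearB /= mulmxBr !mxE. Qed.

Lemma dotrZl n (x : R) (a b : 'rV[R]_n) : dotr (x *: a) b = x * dotr a b.
Proof. by rewrite /dotr -scalemxAl !mxE. Qed.

Lemma dotr_suml n (I : finType) (a : I -> 'rV[R]_n) (b : 'rV[R]_n) :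
  dotr (\sum_i a i) b = \sum_i dotr (a i) b.
Proof. by rewrite /dotr mulmx_suml summxE. Qed.

Lemma dotrC n (a b : 'rV[R]_n) : dotr a b = dotr b a.
Proof. by rewrite /dotr !mxE; apply: eq_bigr => i _; rewrite !mxE mulrC. Qed.

End DotProduct.

(** * Closure properties of the polynomial spaces *)

Section Polynomials.
Context {R : realType} {d : nat} (N : nat).

Lemma polyP_cst (c : R) : @polyP R d N (fun=> c).
Proof.
exists (mpolyC d c); split; last by apply/funext => x; rewrite mevalC.
by rewrite msizeC; case: (c != 0).
Qed.

Lemma polyPB (f g : 'rV[R]_d -> R) :
  polyP N f -> polyP N g -> polyP N (fun x => f x - g x).
Proof.
move=> [p [sp ->]] [q [sq ->]]; exists (p - q); split.
  by rewrite (leq_trans (msizeD_le _ _)) // msizeN geq_max sp.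
by apply/funext => x; rewrite mevalB.
Qed.

Lemma polyPZ (c : R) (f : 'rV[R]_d -> R) :
  polyP N f -> polyP N (fun x => c * f x).
Proof.
move=> [p [sp ->]]; exists (c *: p); split.
  exact: leq_trans (msizeZ_le _ _) sp.
by apply/funext => x; rewrite mevalZ.
Qed.

Lemma polyPn_cst n (c : 'cV[R]_n) : @polyPn R d n N (fun=> c).
Proof. by move=> i; apply: polyP_cst. Qed.

End Polynomials.

(** * Quadrature forms and uniqueness of weakly defined polynomials *)

Section WeakSolve.
Context {R : realType} {d n N : nat} {T : periodic_mesh R d}.
Context (Q : quadrature T N) (k : T).
Implicit Types f g p w : 'rV[R]_d.+1 -> 'cV[R]_n.

Lemma eq_vol_int (f g : 'rV[R]_d.+1 -> R) :
  (forall x, simplex k x -> f x = g x) -> vol_int Q k f = vol_int Q k g.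
Proof.
move=> fg; apply: eq_big_seq => q qk; congr (_ * _).
exact/fg/(vol_nodes qk).
Qed.

Lemma vol_int0 : vol_int Q k (fun=> 0) = 0.
Proof. by apply: big1 => q _; rewrite mulr0. Qed.

Lemma face_int0 : face_int Q k (fun _ _ => 0) = 0.
Proof. by do 2!apply: big1 => ? _; rewrite mulr0. Qed.

Lemma vol_ip0l w : vol_ip Q k (fun=> 0) w = 0.
Proof.
by rewrite -[RHS]vol_int0; apply: eq_vol_int => x _; rewrite dot0c.
Qed.

Lemma vol_ip0r w : vol_ip Q k w (fun=> 0) = 0.
Proof.
by rewrite -[RHS]vol_int0; apply: eq_vol_int => x _; rewrite dotc0.
Qed.

Lemma face_ip0l w : face_ip Q k (fun _ _ => 0) w = 0.
Proof.
rewrite -[RHS]face_int0; congr face_int.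
by apply/funext => i; apply/funext => x; rewrite dot0c.
Qed.

Lemma vol_ipBl f g w :
  vol_ip Q k (fun x => f x - g x) w = vol_ip Q k f w - vol_ip Q k g w.
Proof.
rewrite /vol_ip /vol_int -sumrB; apply: eq_bigr => q _.
by rewrite dotcBl mulrBr.
Qed.

Lemma polyPn_vol_ip_inj p1 p2 : polyPn N p1 -> polyPn N p2 ->
  (forall w, polyPn N w -> vol_ip Q k p1 w = vol_ip Q k p2 w) -> p1 = p2.
Proof.
move=> P1 P2 E; apply/funext => x; apply/colP => i; apply/eqP.
rewrite -subr_eq0; apply/eqP.
pose e y := p1 y i 0 - p2 y i 0.
have Pe : polyP N e by apply: polyPB; [apply: P1|apply: P2].
have [e0|/eqP ne0] := eqVneq e (fun=> 0).
  by have := congr1 (@^~ x) e0.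
(* Testing with [e] in slot [i] and zeros elsewhere reduces the vector pairing to the scalar
   quadrature of [e] squared, to which [vol_posdef] applies. *)
pose w y : 'cV[R]_n := \col_j ((j == i)%:R * e y).
have Pw : polyPn N w.
  move=> j; rewrite (_ : (fun _ => _) = fun y => (j == i)%:R * e y).
    exact: polyPZ.
  by apply/funext => y; rewrite mxE.
have := vol_posdef Q k Pe ne0.
have /eqP := E _ Pw; rewrite -subr_eq0 -vol_ipBl => /eqP.
rewrite /vol_ip /vol_int (eq_bigr (fun q => q.2 * (e q.1 * e q.1))).
  by move=> ->; rewrite ltxx.
move=> q _; congr (_ * _); rewrite dotcE (bigD1 i) //= big1 ?addr0.
  by rewrite !mxE eqxx mul1r.
by move=> j ji; rewrite !mxE (negbTE ji) mul0r mulr0.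
Qed.

(** The candidate [p] rules out the default value of [xget]; uniqueness then identifies the chosen
    solution with [p]. *)
Lemma weak_solve_eq L p : polyPn N p ->
  (forall w, polyPn N w -> vol_ip Q k p w = L w) -> weak_solve Q k L = p.
Proof.
move=> Pp pL; rewrite /weak_solve; case: xgetP => [q _ [Pq qL]|none].
  by apply: polyPn_vol_ip_inj => // w Pw; rewrite qL // pL.
by case: (none p).
Qed.

Lemma weak_solve0 L :
  (forall w, polyPn N w -> L w = 0) -> weak_solve Q k L = (fun=> 0).
Proof.
move=> L0; apply: weak_solve_eq => [|w Pw]; first exact: polyPn_cst.
by rewrite vol_ip0l L0.
Qed.

(** Volume nodes lie in the simplex, so only values of [g] there matter, and a constant is its own
    projection. *)
Lemma L2proj_cst g c :
  (forall x, simplex k x -> g x = c) -> L2proj Q k g = (fun=> c).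
Proof.
move=> gc; apply: weak_solve_eq => [|w _]; first exact: polyPn_cst.
by apply: eq_vol_int => x /gc ->.
Qed.

End WeakSolve.

Lemma partial_cst (R : realType) d (V : normedModType R) (m : 'I_d) (c : V) :
  partial m (fun _ : 'rV[R]_d => c) = fun=> 0.
Proof. by apply/funext => x; rewrite /partial derive_cst. Qed.

(** * Edge determinants of a simplex and Gram determinant of a face *)

Section ClosedSurface.
Context {R : realType} {d : nat}.

Definition edge_matrix (p : 'I_d.+2 -> 'rV[R]_d.+1) (l : 'I_d.+2)
  (s : 'I_d.+1 -> 'I_d.+2) : 'M[R]_d.+1 := \matrix_j (p (s j) - p l).

Definition enumerates_rest (l : 'I_d.+2) (s : 'I_d.+1 -> 'I_d.+2) :=
  [/\ injective s, forall j, s j != l & forall v, v = l \/ exists j, v = s j].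

(* Two edge matrices of a simplex differ by an integer matrix on either side,
   whose determinant is therefore a unit of Z. *)
Lemma edge_matrix_int (p : 'I_d.+2 -> 'rV[R]_d.+1) l s l' s' :
  enumerates_rest l s ->
  exists C : 'M[int]_d.+1, edge_matrix p l' s' = map_mx intr C *m edge_matrix p l s.
Proof.
move=> [injs sl ls].
(* Every edge issued from [p l] is a 0/1 combination of the rows, empty when [v = l]. *)
have combo v : \sum_j (s j == v)%:R *: (p (s j) - p l) = p v - p l.
  have [->|[j0 ->]] := ls v.
    by rewrite subrr big1 // => j _; rewrite (negbTE (sl j)) scale0r.
  rewrite (bigD1 j0) //= eqxx scale1r big1 ?addr0 // => j jj0.
  by rewrite (inj_eq injs) (negbTE jj0) scale0r.
exists (\matrix_(i, j) ((s j == s' i)%:R - (s j == l')%:R)).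
apply/row_matrixP => i; rewrite row_mul mulmx_sum_row !rowK.
have -> : p (s' i) - p l' = (p (s' i) - p l) - (p l' - p l).
  by rewrite opprB addrA subrK.
rewrite -!combo -sumrB; apply: eq_bigr => j _.
by rewrite !mxE !rowK rmorphB /= !natz -!pmulrn scalerBl.
Qed.

Lemma edge_matrix_det (p : 'I_d.+2 -> 'rV[R]_d.+1) l s l' s' :
  enumerates_rest l s -> enumerates_rest l' s' ->
  edge_matrix p l s \in unitmx ->
  `|\det (edge_matrix p l' s')| = `|\det (edge_matrix p l s)|.
Proof.
move=> ls ls' U; have [C EC] := edge_matrix_int p l' s' ls.
have [C' EC'] := edge_matrix_int p l s ls'.
have D0 : \det (edge_matrix p l s) != 0 by rewrite -unitfE.
(* Inserting one integer relation into the other and cancelling the nonzero determinant leaves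
   [\det C' * \det C = 1] in Z. *)
have /eqP : \det (edge_matrix p l s) = \det (edge_matrix p l s) * 1.
  by rewrite mulr1.
rewrite {1}EC' EC !det_mulmx !det_map_mx mulrA mulrC -rmorphM /=.
rewrite (inj_eq (mulfI D0)) -[1]/(1%:~R) eqr_int => /eqP CC.
have : \det C \is a GRing.unit by apply/unitrPr; exists (\det C'); rewrite mulrC.
by rewrite normrM => /orP[]/eqP ->; rewrite ?rmorphN rmorph1 ?normrN normr1 mul1r.
Qed.

(** Base times height for a parallelepiped: the square root is the measure of the base spanned by
    [E], and [nu] is its unit normal. *)
Lemma face_gram_det (h : 'rV[R]_d.+1) (E : 'M[R]_(d, d.+1)) (nu : 'rV[R]_d.+1) :
  dotr nu nu = 1 -> E *m nu^T = 0 -> (col_mx h E : 'M[R]_d.+1) \in unitmx ->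
  Num.sqrt (\det (E *m E^T)) * `|dotr nu h| = `|\det (col_mx h E : 'M[R]_d.+1)|.
Proof.
move=> nu1 Enu U; pose B : 'M[R]_d.+1 := col_mx h E.
(* Coordinates of [nu] in the basis formed by the rows of [B]. Pairing with [nu] kills the rows of
   [E], so the coefficient of [h] is the inverse of [dotr nu h]. *)
pose ab : 'rV[R]_(1 + d) := nu *m invmx B.
pose a := lsubmx ab; pose b := rsubmx ab.
have nuE : nu = a *m h + b *m E.
  by rewrite -mul_row_col hsubmxK mulmxKV.
have hnu : a 0 0 * dotr nu h = 1.
  have := congr1 (fun z => (z *m nu^T) 0 0) nuE.
  rewrite mulmxDl -!mulmxA Enu mulmx0 addr0 [X in _ = X -> _]mxE big_ord1.
  by rewrite [dotr nu h]dotrC => <-.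
pose M : 'M[R]_(1 + d) := col_mx nu E.
have ME : M = block_mx a b 0 1%:M *m col_mx h E.
  by rewrite mul_block_col mul0mx mul1mx add0r -nuE.
have dM : \det M = a 0 0 * \det (col_mx h E : 'M[R]_(1 + d)).
  by rewrite ME det_mulmx det_ublock det1 mulr1 det_mx11.
(* The product of [M] with its transpose is block triangular with diagonal blocks 1 and
   [E *m E^T]. *)
have GM : \det M ^+ 2 = \det (E *m E^T).
  rewrite expr2 -{2}det_tr -det_mulmx tr_col_mx mul_col_row Enu det_ublock.
  by rewrite det_mx11 [_ 0 0]nu1 mul1r.
by rewrite -GM sqrtr_sqr dM normrM mulrAC -normrM hnu normr1 mul1r.
Qed.

End ClosedSurface.

(** * Face areas, normals and barycentric coordinates *)

Section MeshFaces.
Context {R : realType} {d : nat} (T : periodic_mesh R d) (k : T).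

(** With base vertex [lift i ord0], this order puts the apex [i] first, so the edge matrix is an
    apex edge stacked on [face_edges]. *)
Definition face_apex_order (i : 'I_d.+2) (j : 'I_d.+1) : 'I_d.+2 :=
  if unlift ord0 j is Some j' then lift i (lift ord0 j') else i.

Lemma enumerates_lift0 : enumerates_rest (ord0 : 'I_d.+2) (lift ord0).
Proof.
split=> [|j|v]; [exact: lift_inj|by rewrite eq_sym neq_lift|].
by case: (unliftP ord0 v) => [j ->|->]; [right; exists j|left].
Qed.

Lemma enumerates_face_apex (i : 'I_d.+2) :
  enumerates_rest (lift i (ord0 : 'I_d.+1)) (face_apex_order i).
Proof.
rewrite /face_apex_order; split=> [j j'|j|v].
- case: (unliftP ord0 j) => [a ->|->]; case: (unliftP ord0 j') => [b ->|->] //.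
  + by move=> /lift_inj.
  + by move=> /esym/eqP; rewrite (negbTE (neq_lift _ _)).
  + by move=> /eqP; rewrite (negbTE (neq_lift _ _)).
- case: (unliftP ord0 j) => [a _|_]; last exact: neq_lift.
  by rewrite (inj_eq (@lift_inj _ _)) eq_sym neq_lift.
- case: (unliftP i v) => [a ->|->]; last by right; exists ord0; rewrite unlift_none.
  case: (unliftP ord0 a) => [b ->|->]; last by left.
  by right; exists (lift ord0 b); rewrite liftK.
Qed.

Let B := edge_matrix (vertex k) ord0 (lift ord0).

(** Signed distance from the plane of face [i] to the opposite vertex, negative because the normal
    points outward. *)
Let height i := dotr (normal k i) (vertex k i - vertex k (lift i ord0)).

Lemma height_lt0 i : height i < 0. Proof. exact: normal_outward. Qed.

(** Area times altitude is d+1 times the volume of the simplex, hence the same for every face. *)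
Lemma face_area_height i : face_area k i = - ((`|\det B| / d`!%:R) * (height i)^-1).
Proof.
pose Bi := edge_matrix (vertex k) (lift i ord0) (face_apex_order i).
have BiE : Bi = col_mx (vertex k i - vertex k (lift i ord0)) (face_edges k i).
  apply/row_matrixP => j; rewrite rowK /face_apex_order.
  have [a ->|->] := unliftP ord0 j.
    have aE : lift ord0 a = rshift 1 a by apply: val_inj.
    by rewrite [in RHS]aE (@rowKd _ 1) rowK.
  have oE : ord0 = lshift d (ord0 : 'I_1) by apply: val_inj.
  by rewrite [X in row X _]oE (@rowKu _ 1) row_id.
have UB : B \in unitmx := vertex_indep k.
have dBi : `|\det Bi| = `|\det B|.
  exact: edge_matrix_det enumerates_lift0 (enumerates_face_apex i) UB.
have UBi : Bi \in unitmx by rewrite unitmxE unitfE -normr_eq0 dBi normr_eq0 -unitfE.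
have En : face_edges k i *m (normal k i)^T = 0.
  apply/row_matrixP => j; rewrite row_mul rowK row0.
  by apply/rowP => z; rewrite !ord1 [RHS]mxE -[LHS]/(dotr _ _) dotrC normal_orth.
have := @face_gram_det _ _ (vertex k i - vertex k (lift i ord0)) _ _
  (normal_unit k i) En; rewrite -BiE dBi => /(_ UBi).
rewrite ltr0_norm ?height_lt0 // => <-.
have h0 : height i != 0 by rewrite lt_eqF ?height_lt0.
rewrite /face_area -/(height i) !mulrN !mulNr opprK.
by rewrite [X in _ = X]mulrAC mulfK.
Qed.

(* The vectors [normal k i / height i] are the gradients of the barycentric
   coordinates of the simplex, which add up to 1. *)
Lemma barycentric_gradient_sum0 : \sum_i (height i)^-1 *: normal k i = 0.
Proof.
set g := \sum_i _.
have gorth j : dotr g (vertex k (lift ord0 j) - vertex k ord0) = 0.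
  rewrite dotr_suml.
  (* This is the value of the i-th barycentric coordinate at vertex [v]. *)
  have term i v : dotr ((height i)^-1 *: normal k i)
      (vertex k v - vertex k (lift i ord0)) = (i == v)%:R.
    rewrite dotrZl; case: (unliftP i v) => [a ->|->].
      by rewrite normal_orth mulr0 (negbTE (neq_lift _ _)).
    by rewrite eqxx mulVf // lt_eqF // height_lt0.
  rewrite (eq_bigr (fun i => (i == lift ord0 j)%:R - (i == ord0)%:R)).
    rewrite sumrB (bigD1 (lift ord0 j)) //= [X in _ - X](bigD1 ord0) //= !eqxx.
    by rewrite !big1 ?addr0 ?subrr // => i /negbTE ->.
  move=> i _; rewrite -!term -dotrBr; congr dotr.
  by rewrite opprB addrA subrK.
(* A vector orthogonal to d+1 independent edges is zero. *)
have : B *m g^T = 0.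
  apply/row_matrixP => j; rewrite row_mul rowK row0.
  by apply/rowP => z; rewrite !ord1 [RHS]mxE -[LHS]/(dotr _ _) dotrC gorth.
move/(congr1 (mulmx (invmx B))); rewrite mulKmx ?mulmx0; last exact: vertex_indep.
by move/(congr1 trmx); rewrite trmxK trmx0.
Qed.

(** The divergence theorem for constant fields on a simplex. *)
Lemma face_area_normal_sum0 : \sum_i face_area k i *: normal k i = 0.
Proof.
rewrite (eq_bigr (fun i => - (`|\det B| / d`!%:R) *: ((height i)^-1 *: normal k i))).
  by rewrite -scaler_sumr barycentric_gradient_sum0 scaler0.
by move=> i _; rewrite face_area_height scalerA mulNr.
Qed.

End MeshFaces.

(** * Residual and viscosity at piecewise constant states *)

Section PiecewiseConstant.
Context {R : realType} {d n N : nat} (law : conservation_law R n d.+1).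
Context {T : periodic_mesh R d} (Q : quadrature T N).
Context (u : T -> 'rV[R]_d.+1 -> 'cV[R]_n) (c : T -> 'cV[R]_n).
Hypothesis uc : has_states law u c.

Lemma proj_entropy_var_cst k :
  proj_entropy_var law Q u k = fun=> entropy_var law (c k).
Proof. by apply: L2proj_cst => x /(uc k).2 ->. Qed.

Lemma entropy_residual_cst k : entropy_residual law Q u k = 0.
Proof.
rewrite /entropy_residual; apply: big1 => m _.
rewrite proj_entropy_var_cst partial_cst vol_ip0r add0r.
rewrite /face_int (eq_bigr (fun i => entropy_potential law m (c k) *
    (face_area k i *: normal k i) 0 m)).
  by rewrite -mulr_sumr -summxE face_area_normal_sum0 mxE mulr0.
(* The face weights add up to the area, and the entropy projection returns the state [c k]. *)
move=> i _; rewrite -(face_exact Q) mxE mulr_suml mulr_sumr.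
apply: eq_bigr => q _.
rewrite /entropy_proj proj_entropy_var_cst (state_ofK (uc k).1).
ring.
Qed.

Context (Kv : (T -> 'rV[R]_d.+1 -> 'cV[R]_n) -> T -> 'rV[R]_d.+1 ->
  'I_d.+1 -> 'I_d.+1 -> 'M[R]_n) (v0 : 'rV[R]_d.+1) (delta : R).

Lemma visc_coeff_cst k : visc_coeff law Q Kv v0 delta u k = 0.
Proof.
by rewrite /visc_coeff /visc_a entropy_residual_cst minxx oppr0 !mul0r.
Qed.

Lemma visc_sigma_cst i : visc_sigma law Q Kv v0 delta u i = fun _ _ => 0.
Proof.
apply/funext => k; apply: weak_solve0 => w _.
rewrite -[RHS](vol_ip0l Q k w); congr vol_ip; apply/funext => x.
by apply: big1 => j _; rewrite visc_coeff_cst scale0r.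
Qed.

(** The face terms involve traces from neighbours; these vanish too, since [visc_sigma] is zero on
    all elements. *)
Lemma gvisc_cst k : gvisc law Q Kv v0 delta u k = fun=> 0.
Proof.
apply: weak_solve0 => w _; apply: big1 => i _; rewrite visc_sigma_cst.
rewrite -[RHS](addr0 0); congr (_ + _).
  rewrite -[RHS](vol_ip0l Q k (partial i w)); congr vol_ip.
  by apply/funext => x; rewrite oppr0.
rewrite -[RHS](face_ip0l Q k w); congr face_ip.
apply/funext => e; apply/funext => x.
by rewrite /avg /jump /ext_trace subr0 !addr0 !scaler0 addr0 scaler0.
Qed.

End PiecewiseConstant.

Unset Implicit Arguments.

Theorem mainTheorem4 (R : realType) (d n N : nat)
  (law : conservation_law R n d.+1) (T : periodic_mesh R d)
  (Q : quadrature T N)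
  (Kv : (T -> 'rV[R]_d.+1 -> 'cV[R]_n) -> T -> 'rV[R]_d.+1 ->
        'I_d.+1 -> 'I_d.+1 -> 'M[R]_n)
  (Kv_psd : forall u k x, psd_blocks (Kv u k x))
  (v0 : 'rV[R]_d.+1) (delta : R) (delta_gt0 : 0 < delta)
  (fstar : (T -> 'rV[R]_d.+1 -> 'cV[R]_n) -> T -> 'I_d.+2 ->
           'rV[R]_d.+1 -> 'cV[R]_n) :
  (forall u, piecewise_constant law u ->
     [/\ forall k, entropy_residual law Q u k = 0,
         forall k, visc_coeff law Q Kv v0 delta u k = 0
       & forall k, gvisc law Q Kv v0 delta u k = (fun=> 0)]) /\
  (contact_preserving law (baseline_scheme law Q fstar) ->
   contact_preserving law (visc_scheme law Q Kv v0 delta fstar)).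
Proof.
split=> [u [c uc]|base u [wu [c uc ctc]] k].
  split=> k; [exact: entropy_residual_cst uc k|exact: visc_coeff_cst|].
  exact: gvisc_cst.
have [P0 E0] : polyPn N (fun=> 0) /\ _ := base u (conj wu (ex_intro2 _ _ c uc ctc)) k.
(* A stationary contact is piecewise constant, so the viscous right-hand side is zero and the
   baseline equation remains. *)
by split=> // w Pw; rewrite (gvisc_cst Q uc) vol_ip0l; apply: E0.
Qed.
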